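(* Let $\mathfrak{X}$ be a $p$-homomorph. Then the following are equivalent: (a) $\mathfrak{X}$ is a Gaschütz class, that is, every soluble restricted Lie algebra $(L,[p])$ has at least one $\mathfrak{X}$-covering subalgebra; (b) $\mathfrak{X}$ is projective, that is, every soluble restricted Lie algebra $(L,[p])$ has at least one $\mathfrak{X}$-projector; (c) $\mathfrak{X}$ is a $p$-Schunck class.
   Context: All Lie algebras are finite-dimensional over a fixed field $F$ of characteristic $p\neq 0$. A restricted Lie algebra $(L,[p])$ is a Lie algebra $L$ with a $p$-operation $x\mapsto x^{[p]}$ in the usual sense (so $\operatorname{ad}(x)^p=\operatorname{ad}(x^{[p]})$, etc.); it is soluble if the Lie algebra $L$ is. A $[p]$-subalgebra is a subalgebra $U$ with $U^{[p]}\subseteq U$; a $[p]$-ideal is an ideal which is a $[p]$-subalgebra. For a $[p]$-ideal $K$, the quotient $L/K$ carries the induced $p$-operation; isomorphisms of restricted Lie algebras respect the $p$-operations. A minimal $[p]$-ideal is one minimal among the nonzero $[p]$-ideals. A class of soluble restricted Lie algebras is a collection of such algebras closed under isomorphism. A $p$-homomorph is a non-empty class of soluble restricted Lie algebras such that $(L,[p])\in\mathfrak{X}$ and $K$ a $[p]$-ideal of $L$ imply $(L/K,[p])\in\mathfrak{X}$. A soluble restricted Lie algebra $(L,[p])$ is primitive if it has a minimal $[p]$-ideal $A$ whose centraliser $\mathcal{C}_L(A)$ equals $A$. A $p$-Schunck class is a non-empty class $\mathfrak{X}$ which is equal to the class of all soluble restricted Lie algebras $(L,[p])$ such that every primitive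 quotient $(L/K,[p])$ ($K$ a $[p]$-ideal) is in $\mathfrak{X}$. A $[p]$-subalgebra $U$ of $(L,[p])$ is $\mathfrak{X}$-maximal in $L$ if it is maximal in the set of those $[p]$-subalgebras of $L$ which are in $\mathfrak{X}$. It is an $\mathfrak{X}$-projector of $L$ if, for every $[p]$-ideal $K$ of $L$, $(U+K)/K$ is $\mathfrak{X}$-maximal in $L/K$. It is an $\mathfrak{X}$-covering subalgebra of $L$ if $U\in\mathfrak{X}$ and, whenever $V$ is a $[p]$-subalgebra of $L$ containing $U$ and $K$ is a $[p]$-ideal of $V$ with $V/K\in\mathfrak{X}$, we have $U+K=V$. *)

(* Defs.v *)
From HB Require Import structures.
From mathcomp Require Import all_boot all_algebra.

Set Implicit Arguments.
Unset Strict Implicit.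
Unset Printing Implicit Defensive.

Import GRing.Theory.
Local Open Scope ring_scope.

HB.mixin Record isLieAlgebra (F : fieldType) L of Vector F L := {
  lbr : L -> L -> L;
  lbr_linearl : forall y : L, linear (fun x => lbr x y);
  lbr_linearr : forall x : L, linear (lbr x);
  lbrxx : forall x : L, lbr x x = 0;
  lbr_jacobi : forall x y z : L,
    lbr x (lbr y z) + lbr y (lbr z x) + lbr z (lbr x y) = 0
}.

#[short(type="lieAlgType")]
HB.structure Definition LieAlgebra (F : fieldType) :=
  {L of isLieAlgebra F L & Vector F L}.

(* jacobson_coef n j x y is the coefficient of t^j in ad(t x + y)^n (x),
   computed in the extension of L by F[t]. *)
Fixpoint jacobson_coef (F : fieldType) (L : lieAlgType F) (n j : nat)
    (x y : L) : L :=
  match n with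
  | 0 => if j is 0 then x else 0
  | n'.+1 => lbr y (jacobson_coef n' j x y)
             + (if j is j'.+1 then lbr x (jacobson_coef n' j' x y) else 0)
  end.

(* Jacobson's s_i(x, y): i s_i(x, y) is the coefficient of t^(i-1) in
   ad(t x + y)^(p-1) (x), for 0 < i < p. *)
Definition jacobson (F : fieldType) (L : lieAlgType F) (p i : nat) (x y : L)
    : L :=
  i%:R^-1 *: jacobson_coef p.-1 i.-1 x y.

(* The axioms make sense for every p; the intended use is p = char F. *)
HB.mixin Record hasPOperation (F : fieldType) (p : nat) L
    of LieAlgebra F L := {
  ppow : L -> L;
  ppow_ad : forall x y : L, lbr (ppow x) y = iter p (lbr x) y;
  ppowZ : forall (a : F) (x : L), ppow (a *: x) = a ^+ p *: ppow x;
  ppowD : forall x y : L,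
    ppow (x + y) = ppow x + ppow y + \sum_(1 <= i < p) jacobson p i x y
}.

#[short(type="rlieType")]
HB.structure Definition RLie (F : fieldType) (p : nat) :=
  {L of hasPOperation F p L & LieAlgebra F L}.

Section LieTheory.
Variables (F : fieldType) (L : lieAlgType F).
Implicit Types x y z : L.

Lemma lbrDl x y z : lbr (x + y) z = lbr x z + lbr y z.
Proof. by have := lbr_linearl z 1 x y; rewrite !scale1r. Qed.
Lemma lbrDr x y z : lbr x (y + z) = lbr x y + lbr x z.
Proof. by have := lbr_linearr x 1 y z; rewrite !scale1r. Qed.
Lemma lbr0l x : lbr 0 x = 0.
Proof. by apply: (addrI (lbr 0 x)); rewrite -lbrDl !addr0. Qed.
Lemma lbr0r x : lbr x 0 = 0.
Proof. by apply: (addrI (lbr x 0)); rewrite -lbrDr !addr0. Qed.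
Lemma lbrZl a x y : lbr (a *: x) y = a *: lbr x y.
Proof. by have := lbr_linearl y a x 0; rewrite !addr0 lbr0l addr0. Qed.
Lemma lbrZr a x y : lbr x (a *: y) = a *: lbr x y.
Proof. by have := lbr_linearr x a y 0; rewrite !addr0 lbr0r addr0. Qed.
Lemma lbrC x y : lbr x y = - lbr y x.
Proof.
by apply/eqP; rewrite -addr_eq0; have := lbrxx (x + y);
   rewrite lbrDl !lbrDr !lbrxx add0r addr0 => ->.
Qed.
Lemma lbrBl x y z : lbr (x - y) z = lbr x z - lbr y z.
Proof. by rewrite lbrDl -scaleN1r lbrZl scaleN1r. Qed.
Lemma lbrBr x y z : lbr x (y - z) = lbr x y - lbr x z.
Proof. by rewrite lbrDr -scaleN1r lbrZr scaleN1r. Qed.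

(* The span of all brackets of U and V; a basis suffices by bilinearity,
   see memv_lbrv. *)
Definition lbrv (U V : {vspace L}) : {vspace L} :=
  <<[seq lbr u v | u <- vbasis U, v <- vbasis V]>>%VS.

Lemma memv_lbrv (U V : {vspace L}) u v :
  u \in U -> v \in V -> lbr u v \in lbrv U V.
Proof.
move=> /coord_vbasis -> /coord_vbasis ->.
have suml (I : finType) (f : I -> L) y :
    lbr (\sum_i f i) y = \sum_i lbr (f i) y.
  by apply: (big_morph (fun x => lbr x y) (fun a b => lbrDl a b y) (lbr0l y)).
have sumr (I : finType) (f : I -> L) y :
    lbr y (\sum_i f i) = \sum_i lbr y (f i).
  exact: (big_morph (lbr y) (lbrDr y) (lbr0r y)).
rewrite suml; apply: memv_suml => i _; rewrite lbrZl sumr; apply: memvZ.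
apply: memv_suml => j _; rewrite lbrZr; apply: memvZ; apply: memv_span.
by apply: allpairs_f; rewrite mem_nth // size_tuple.
Qed.

Fixpoint derived_series (n : nat) : {vspace L} :=
  if n is n'.+1 then lbrv (derived_series n') (derived_series n')
  else fullv.

Definition soluble : Prop := exists n, derived_series n = 0%VS.

Definition in_centraliser (A : {vspace L}) (x : L) : Prop :=
  forall a, a \in A -> lbr x a = 0.
End LieTheory.
Arguments soluble {F} L.

Section RestrictedMorphisms.
Variables (F : fieldType) (p : nat).
Implicit Types L M : rlieType F p.

Definition rlie_morphism L M (f : 'Hom(L, M)) : Prop :=
  (forall x y, f (lbr x y) = lbr (f x) (f y)) /\
  (forall x, f (ppow x) = ppow (f x)).

Definition rlie_iso L M : Prop :=
  exists f : 'Hom(L, M), rlie_morphism f /\ bijective f.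

Record psubalg L := PSubalg {
  psubalg_val :> {vspace L};
  psubalg_lbr : forall x y,
    x \in psubalg_val -> y \in psubalg_val -> lbr x y \in psubalg_val;
  psubalg_ppow : forall x, x \in psubalg_val -> ppow x \in psubalg_val
}.

Record pideal L := PIdeal {
  pideal_val :> {vspace L};
  pideal_lbr : forall x y, y \in pideal_val -> lbr x y \in pideal_val;
  pideal_ppow : forall x, x \in pideal_val -> ppow x \in pideal_val
}.

Definition min_pideal L (A : pideal L) : Prop :=
  (A : {vspace L}) <> 0%VS /\
  forall B : pideal L, (B : {vspace L}) <> 0%VS -> (B <= A)%VS ->
    (B : {vspace L}) = A.

Definition primitive L : Prop :=
  soluble L /\
  exists A : pideal L,
    min_pideal A /\ forall x, in_centraliser A x <-> x \in A.
End RestrictedMorphisms.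

Section Subalgebra.
Variables (F : fieldType) (p : nat) (L : rlieType F p) (U : psubalg L).

Definition psub : Type := subvs_of U.
HB.instance Definition _ := Vector.on psub.
Implicit Types u v w : psub.

Definition psub_val : psub -> L := vsval.

Definition psub_lbr u v : psub := Subvs (psubalg_lbr (subvsP u) (subvsP v)).
Definition psub_ppow u : psub := Subvs (psubalg_ppow (subvsP u)).

Let vI : injective psub_val. Proof. exact: subvs_inj. Qed.
Let vP a u v : psub_val (a *: u + v) = a *: psub_val u + psub_val v.
Proof. by []. Qed.

Fact psub_linearl v : linear (fun u => psub_lbr u v).
Proof. by move=> a u w; apply: vI; rewrite vP /= lbrDl lbrZl. Qed.
Fact psub_linearr u : linear (psub_lbr u).
Proof. by move=> a v w; apply: vI; rewrite vP /= lbrDr lbrZr. Qed.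
Fact psub_lbrxx u : psub_lbr u u = 0.
Proof. by apply: vI; rewrite /= lbrxx. Qed.
Fact psub_jacobi u v w :
  psub_lbr u (psub_lbr v w) + psub_lbr v (psub_lbr w u)
    + psub_lbr w (psub_lbr u v) = 0.
Proof. by apply: vI; exact: lbr_jacobi. Qed.
HB.instance Definition _ :=
  isLieAlgebra.Build F psub psub_linearl psub_linearr psub_lbrxx psub_jacobi.

Fact psub_jacobson_coef n j u v :
  psub_val (jacobson_coef n j u v)
    = jacobson_coef n j (psub_val u) (psub_val v).
Proof.
elim: n j => [|n IHn] [|j] //=; rewrite -!IHn // !addr0.
Qed.

Fact psub_ppow_ad u v : lbr (psub_ppow u) v = iter p (lbr u) v.
Proof.
have iterE n : psub_val (iter n (lbr u) v)
    = iter n (lbr (psub_val u)) (psub_val v) by elim: n => //= n <-.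
by apply: vI; rewrite iterE -ppow_ad.
Qed.
Fact psub_ppowZ a u : psub_ppow (a *: u) = a ^+ p *: psub_ppow u.
Proof. by apply: vI; exact: ppowZ. Qed.
Fact psub_ppowD u v :
  psub_ppow (u + v)
    = psub_ppow u + psub_ppow v + \sum_(1 <= i < p) jacobson p i u v.
Proof.
have vD w w' : psub_val (w + w') = psub_val w + psub_val w' by [].
have v0 : psub_val 0 = 0 by [].
apply: vI; rewrite !vD (big_morph psub_val vD v0).
rewrite [LHS](ppowD (psub_val u) (psub_val v)); congr (_ + _).
by apply: eq_bigr => i _; rewrite /jacobson -psub_jacobson_coef.
Qed.
HB.instance Definition _ :=
  hasPOperation.Build F p psub psub_ppow_ad psub_ppowZ psub_ppowD.

Definition psub_incl : 'Hom(psub, L) := linfun (vsval : subvs_of U -> L).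
End Subalgebra.

(* The quotient L / K is carried by the complement K^C of K, its operations
   being those of L followed by the projection quo_proj along K. That this is
   the quotient is the content of quo_proj_surj, ker_quo_proj and
   quo_proj_morph. *)
Section Quotient.
Variables (F : fieldType) (p : nat) (L : rlieType F p) (K : pideal L).

Definition pquo : Type := subvs_of (K^C)%VS.
HB.instance Definition _ := Vector.on pquo.
Implicit Types u v w : pquo.

Definition quo_proj_fun (x : L) : pquo :=
  vsproj (K^C)%VS (daddv_pi (K^C)%VS K x).
Fact quo_proj_linear : linear quo_proj_fun.
Proof. by move=> a x y; rewrite /quo_proj_fun !linearP. Qed.
HB.instance Definition _ :=
  GRing.isLinear.Build F L pquo _ quo_proj_fun quo_proj_linear.
Definition quo_proj : 'Hom(L, pquo) := linfun quo_proj_fun.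

Definition quo_rep (u : pquo) : L := vsval u.

Let piP a x y : quo_proj (a *: x + y) = a *: quo_proj x + quo_proj y.
Proof. exact: linearP. Qed.
Let piZ a x : quo_proj (a *: x) = a *: quo_proj x.
Proof. exact: linearZ. Qed.
Let piD : {morph quo_proj : x y / x + y}. Proof. exact: linearD. Qed.
Let capCK : (K^C :&: K = 0)%VS. Proof. by rewrite capvC capv_compl. Qed.

Fact quo_repK : cancel quo_rep quo_proj.
Proof.
move=> u; rewrite lfunE /= /quo_proj_fun daddv_pi_id ?subvsP //.
exact: vsvalK.
Qed.
Lemma quo_proj_surj u : exists x, quo_proj x = u.
Proof. by exists (quo_rep u); rewrite quo_repK. Qed.
Fact quo_rep_proj x : x - quo_rep (quo_proj x) \in K.
Proof.
rewrite lfunE /= /quo_rep /quo_proj_fun vsprojK ?memv_pi //.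
have E: daddv_pi (K^C)%VS K x + daddv_pi K (K^C)%VS x = x.
  by rewrite daddv_pi_add // addvC addv_complf memvf.
by rewrite -{1}E addrC addKr memv_pi.
Qed.
Lemma quo_proj_eq0 x : (quo_proj x == 0) = (x \in K).
Proof.
apply/eqP/idP => [x0|xK].
  by have := quo_rep_proj x; rewrite x0 subr0.
have: quo_rep (quo_proj x) \in (K^C :&: K)%VS.
  rewrite memv_cap subvsP -[X in X \in _](subKr x) rpredB //.
  exact: quo_rep_proj.
by rewrite capCK memv0 => /eqP x0; apply: subvs_inj.
Qed.
Lemma ker_quo_proj : lker quo_proj = K :> {vspace L}.
Proof. by apply/vspaceP => x; rewrite memv_ker quo_proj_eq0. Qed.
Fact eq_quo_proj x y : x - y \in K -> quo_proj x = quo_proj y.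
Proof.
by rewrite -quo_proj_eq0 linearB /= subr_eq0 => /eqP.
Qed.

Definition pquo_lbr u v : pquo := quo_proj (lbr (quo_rep u) (quo_rep v)).
Definition pquo_ppow u : pquo := quo_proj (ppow (quo_rep u)).

Fact pideal_lbrl x y : x \in K -> lbr x y \in K.
Proof. by move=> xK; rewrite lbrC rpredN pideal_lbr. Qed.

Fact quo_proj_lbr x y :
  quo_proj (lbr x y) = pquo_lbr (quo_proj x) (quo_proj y).
Proof.
apply: eq_quo_proj.
rewrite -(subrKA (lbr (quo_rep (quo_proj x)) y)) -lbrBl -lbrBr rpredD //.
  exact/pideal_lbrl/quo_rep_proj.
exact/pideal_lbr/quo_rep_proj.
Qed.

Fact pquo_linearl v : linear (fun u => pquo_lbr u v).
Proof.
move=> a u w; rewrite -[u]quo_repK -[v]quo_repK -[w]quo_repK.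
by rewrite -piP -!quo_proj_lbr -piP lbrDl lbrZl.
Qed.
Fact pquo_linearr u : linear (pquo_lbr u).
Proof.
move=> a v w; rewrite -[u]quo_repK -[v]quo_repK -[w]quo_repK.
by rewrite -piP -!quo_proj_lbr -piP lbrDr lbrZr.
Qed.
Fact pquo_lbrxx u : pquo_lbr u u = 0.
Proof. by rewrite /pquo_lbr lbrxx linear0. Qed.
Fact pquo_jacobi u v w :
  pquo_lbr u (pquo_lbr v w) + pquo_lbr v (pquo_lbr w u)
    + pquo_lbr w (pquo_lbr u v) = 0.
Proof.
rewrite -[u]quo_repK -[v]quo_repK -[w]quo_repK -!quo_proj_lbr.
by rewrite -!piD lbr_jacobi linear0.
Qed.
HB.instance Definition _ :=
  isLieAlgebra.Build F pquo pquo_linearl pquo_linearr pquo_lbrxx pquo_jacobi.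

Fact jacobson_coef_pideal n j x y :
  y \in K -> (j < n)%N -> jacobson_coef n j x y \in K.
Proof.
move=> yK; elim: n j => // n IHn j jn /=; rewrite rpredD ?pideal_lbrl //.
by case: j jn => [|j] jn; rewrite ?rpred0 ?pideal_lbr ?IHn.
Qed.

Fact quo_proj_ppow x : quo_proj (ppow x) = pquo_ppow (quo_proj x).
Proof.
apply: eq_quo_proj; set y := quo_rep _.
have kK: x - y \in K by exact: quo_rep_proj.
have -> : ppow x = ppow (y + (x - y)) by rewrite addrC subrK.
rewrite ppowD -[X in X - _]addrA addrAC subrr add0r rpredD ?pideal_ppow //.
rewrite big_nat; apply: rpred_sum => i /andP[i_gt0 ip].
rewrite memvZ ?jacobson_coef_pideal //.
by case: i p i_gt0 ip => [|i] [|q].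
Qed.

Fact quo_proj_jacobson_coef n j x y :
  quo_proj (jacobson_coef n j x y)
    = jacobson_coef n j (quo_proj x) (quo_proj y).
Proof.
elim: n j => [|n IHn] [|j] //=; rewrite ?linear0 //.
  by rewrite !addr0 quo_proj_lbr -IHn.
by rewrite piD !quo_proj_lbr -!IHn.
Qed.

Fact pquo_ppow_ad u v : lbr (pquo_ppow u) v = iter p (lbr u) v.
Proof.
rewrite -[u]quo_repK -[v]quo_repK -quo_proj_ppow.
have iterE n x y : quo_proj (iter n (lbr x) y)
    = iter n (lbr (quo_proj x)) (quo_proj y).
  by elim: n => //= n <-; rewrite quo_proj_lbr.
by rewrite -iterE -ppow_ad quo_proj_lbr.
Qed.
Fact pquo_ppowZ a u : pquo_ppow (a *: u) = a ^+ p *: pquo_ppow u.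
Proof.
by rewrite -[u]quo_repK -piZ -!quo_proj_ppow -piZ ppowZ.
Qed.
Fact pquo_ppowD u v :
  pquo_ppow (u + v)
    = pquo_ppow u + pquo_ppow v + \sum_(1 <= i < p) jacobson p i u v.
Proof.
rewrite -[u]quo_repK -[v]quo_repK -piD -!quo_proj_ppow ppowD !piD.
congr (_ + _); have pi0 : quo_proj 0 = 0 by exact: linear0.
rewrite (big_morph quo_proj piD pi0); apply: eq_bigr => i _.
by rewrite /jacobson piZ quo_proj_jacobson_coef.
Qed.
HB.instance Definition _ :=
  hasPOperation.Build F p pquo pquo_ppow_ad pquo_ppowZ pquo_ppowD.

Lemma quo_proj_morph : rlie_morphism quo_proj.
Proof. by split; [exact: quo_proj_lbr | exact: quo_proj_ppow]. Qed.

(* (U + K) / K as a [p]-subalgebra of L / K. *)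
Section Image.
Variable U : psubalg L.

Fact quo_img_eq : (quo_proj @: (U + K) = quo_proj @: U)%VS.
Proof.
rewrite limgD; apply/addv_idPl/subvP => _ /memv_imgP[x xK ->].
by have /eqP -> : quo_proj x == 0; rewrite ?mem0v ?quo_proj_eq0.
Qed.
Fact quo_img_lbr u v :
  u \in (quo_proj @: (U + K))%VS -> v \in (quo_proj @: (U + K))%VS ->
  lbr u v \in (quo_proj @: (U + K))%VS.
Proof.
rewrite quo_img_eq => /memv_imgP[x xU ->] /memv_imgP[y yU ->].
by rewrite -(proj1 quo_proj_morph) memv_img ?psubalg_lbr.
Qed.
Fact quo_img_ppow u :
  u \in (quo_proj @: (U + K))%VS -> ppow u \in (quo_proj @: (U + K))%VS.
Proof.
rewrite quo_img_eq => /memv_imgP[x xU ->].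
by rewrite -(proj2 quo_proj_morph) memv_img ?psubalg_ppow.
Qed.
Definition quo_img : psubalg pquo := PSubalg quo_img_lbr quo_img_ppow.
End Image.
End Quotient.

Section Classes.
Variables (F : fieldType) (p : nat).
Implicit Types (X : rlieType F p -> Prop) (L M : rlieType F p).

Definition soluble_class X : Prop :=
  (forall L, X L -> soluble L) /\
  (forall L M, rlie_iso L M -> X L -> X M).

Definition p_homomorph X : Prop :=
  [/\ soluble_class X,
      exists L, X L
    & forall L (K : pideal L), X L -> X (pquo K)].

Definition p_Schunck_class X : Prop :=
  [/\ soluble_class X,
      exists L, X L
    & forall L, X L <->
        soluble L /\ forall K : pideal L, primitive (pquo K) -> X (pquo K)].

Definition X_maximal X L (U : psubalg L) : Prop :=
  X (psub U) /\
  forall V : psubalg L, X (psub V) -> (U <= V)%VS -> (V : {vspace L}) = U.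

Definition projector X L (U : psubalg L) : Prop :=
  forall K : pideal L, X_maximal X (quo_img K U).

(* A [p]-ideal K of V lives in psub V, hence the embedding into L. *)
Definition covering_subalg X L (U : psubalg L) : Prop :=
  X (psub U) /\
  forall V : psubalg L, (U <= V)%VS ->
  forall K : pideal (psub V), X (pquo K) ->
    (U + psub_incl V @: K)%VS = V.

Definition Gaschutz X : Prop :=
  forall L, soluble L -> exists U : psubalg L, covering_subalg X U.

Definition projective X : Prop :=
  forall L, soluble L -> exists U : psubalg L, projector X U.
End Classes.

(* Main.v *)
From HB Require Import structures.
Require Import Defs.
From mathcomp Require Import all_boot all_algebra.
From Stdlib Require Import Classical.

Set Implicit Arguments.
Unset Strict Implicit.
Unset Printing Implicit Defensive.

Import GRing.Theory.
Local Open Scope ring_scope.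

(** The three properties are proved in a cycle: Gaschütz, projective, Schunck,
    Gaschütz. Throughout, a covering subalgebra U of L is handled through
    [covers]: U is in X and, whenever i : N -> L is a morphism whose image
    contains U and f : N -> M is a surjective morphism with M in X, already
    i^-1(U) maps onto M. Allowing arbitrary N and i spares most identifications
    between nested subalgebras and quotients, and by [coversP] costs nothing.

    Gaschütz to projective ([covers_projector]): if (U + K)/K lies in V/K with
    V/K in X, apply the covering property to V and K to get V = U + K.

    Projective to Schunck ([projective_Schunck]): let all primitive quotients
    of L be in X; by induction on the dimension all proper quotients of L are
    in X. A projector U is in X and satisfies U + K = L for every nonzero
    [p]-ideal K. Suppose U <> L, and let A be a minimal [p]-ideal. Then A is
    abelian, and C_U(A) is a [p]-ideal of L = U + A contained in U, hence zero.
    So C_L(A) = A, and L is in X as a primitive quotient of itself.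

    Schunck to Gaschütz ([Schunck_covers]), by induction on the dimension: if
    K is a nonzero [p]-ideal and E/K a covering subalgebra of L/K with E <> L,
    a covering subalgebra of E is one of L ([covers_lift]). There remains the
    case where L is not in X but L/K is for every nonzero K. Then L is
    primitive, with a self-centralising minimal [p]-ideal A, and any complement
    of A is a covering subalgebra ([covers_complement]).

    The existence of a complement ([primitive_complement]) is where the
    p-operation replaces cohomology. If A = L the complement is 0. Otherwise
    let z be outside A with [z, L] in A. Then ad z commutes with the action of
    L on A, so it is invertible on A by Schur's argument, and L = C_L(z) + A is
    a splitting by a [p]-subalgebra.
    Such a z can be found as b^[p], with b in the last term B of the derived
    series not contained in A: ad b maps L to B and B to A, whence
    ad(b)^p L <= A. If all the b^[p] were in A, then B would act on A by
    commuting nilpotent operators, and so trivially on A by minimality, which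
    contradicts C_L(A) = A ([central_mod_self_centralising]). *)

(** * Subspaces and linear maps *)

Section VectorSpaces.
Variable F : fieldType.
Implicit Types V W : vectType F.

(** Take a subspace of largest dimension on which P holds. This lets all
    subalgebras and ideals below be specified by their elements. *)
Lemma vspace_of_pred V (P : V -> Prop) :
    P 0 -> (forall a x y, P x -> P y -> P (a *: x + y)) ->
  exists U : {vspace V}, forall x, x \in U <-> P x.
Proof.
move=> P0 PL.
suff ext n : forall U : {vspace V}, (\dim {:V} - \dim U < n)%N ->
    (forall x, x \in U -> P x) ->
    exists U' : {vspace V}, forall x, x \in U' <-> P x.
  by apply: (ext _ 0%VS (ltnSn _)) => x; rewrite memv0 => /eqP->.
elim: n => // n IHn U dimU UP.
(* Either U can be enlarged by one vector, or it is all of P. *)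
have [[x [Px xU]]|maxU] := classic (exists x, P x /\ x \notin U); last first.
  exists U => x; split=> [/UP //|Px]; apply/negPn/negP => xU.
  by apply: maxU; exists x.
apply: (IHn (U + <[x]>)%VS) => [|_ /memv_addP[u uU [_ /vlineP[a ->] ->]]].
  have ltU : (\dim U < \dim (U + <[x]>))%N.
    rewrite ltnNge; apply: contra xU => dimle.
    have/eqP-> : U == (U + <[x]>)%VS by rewrite eqEdim addvSl.
    by rewrite (subvP (addvSr _ _)) ?memv_line.
  have leU := dimvS (subvf (U + <[x]>)).
  rewrite -ltnS; apply: leq_ltn_trans dimU => //.
  exact: ltn_sub2l (leq_trans ltU leU) ltU.
by rewrite addrC; apply: PL => //; apply: UP.
Qed.

Lemma hom_of_linear V W (g : V -> W) :
  linear g -> exists f : 'Hom(V, W), f =1 g.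
Proof.
move=> lin_g; pose gM := GRing.isLinear.Build F V W _ g lin_g.
pose g' : {linear V -> W} := HB.pack g gM.
by exists (linfun g') => x; rewrite lfunE.
Qed.

End VectorSpaces.

(** * Ideals, subalgebras and centralisers *)

Section RestrictedLie.
Variables (F : fieldType) (p : nat).
Hypothesis charFp : p \in [pchar F].
Implicit Types (L M N : rlieType F p).

Let p_gt1 : (1 < p)%N.
Proof. by rewrite prime_gt1 ?(pcharf_prime charFp). Qed.
Let p_gt0 : (0 < p)%N. Proof. exact: ltnW. Qed.

Lemma ppow0 L : ppow (0 : L) = 0.
Proof. by rewrite -[0 in LHS](scale0r 0) ppowZ expr0n gtn_eqF // scale0r. Qed.

Lemma lbr_leibniz L (x y z : L) :
  lbr x (lbr y z) = lbr (lbr x y) z + lbr y (lbr x z).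
Proof.
have lbrNr u v : lbr u (- v) = - lbr u v :> L.
  by rewrite -scaleN1r lbrZr scaleN1r.
apply/eqP; rewrite [lbr (lbr x y) z]lbrC [lbr x z]lbrC lbrNr -opprD -addr_eq0.
by rewrite [X in _ + X]addrC addrA lbr_jacobi.
Qed.

Lemma lbr_eq0C L (x y : L) : lbr x y = 0 -> lbr y x = 0.
Proof. by move=> xy0; rewrite lbrC xy0 oppr0. Qed.

Lemma ppow_centralises L (x y : L) : lbr x y = 0 -> lbr (ppow x) y = 0.
Proof.
move=> xy0; rewrite ppow_ad.
suff iter0 n : (0 < n)%N -> iter n (lbr x) y = 0 by apply: iter0.
by case: n => // n _; rewrite iterSr xy0; elim: n => //= n ->; rewrite lbr0r.
Qed.

Lemma pideal_of_pred L (P : L -> Prop) :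
    P 0 -> (forall a x y, P x -> P y -> P (a *: x + y)) ->
    (forall x y, P y -> P (lbr x y)) -> (forall x, P x -> P (ppow x)) ->
  exists K : pideal L, forall x, x \in K <-> P x.
Proof.
move=> P0 PL Plbr Pppow; have [U PU] := vspace_of_pred P0 PL.
have Ul x y : y \in U -> lbr x y \in U by move=> /PU/(Plbr x)/PU.
have Up x : x \in U -> ppow x \in U by move=> /PU/Pppow/PU.
by exists (PIdeal Ul Up).
Qed.

Lemma psubalg_of_pred L (P : L -> Prop) :
    P 0 -> (forall a x y, P x -> P y -> P (a *: x + y)) ->
    (forall x y, P x -> P y -> P (lbr x y)) -> (forall x, P x -> P (ppow x)) ->
  exists U : psubalg L, forall x, x \in U <-> P x.
Proof.
move=> P0 PL Plbr Pppow; have [U PU] := vspace_of_pred P0 PL.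
have Ul x y : x \in U -> y \in U -> lbr x y \in U.
  by move=> /PU Px /PU Py; apply/PU/Plbr.
have Up x : x \in U -> ppow x \in U by move=> /PU/Pppow/PU.
by exists (PSubalg Ul Up).
Qed.

Lemma psubalg_full L : exists U : psubalg L, forall x, x \in U.
Proof.
have [||||U Ux] // := @psubalg_of_pred L (fun=> True).
by exists U => x; apply/Ux.
Qed.

Lemma pideal_full L : exists K : pideal L, forall x, x \in K.
Proof.
have [||||K KP] // := @pideal_of_pred L (fun=> True).
by exists K => x; apply/KP.
Qed.

Lemma pideal_zero L : exists K : pideal L, forall x, x \in K <-> x = 0.
Proof.
apply: pideal_of_pred => [//|a x y -> ->|x y ->|x ->].
- by rewrite scaler0 addr0.
- by rewrite lbr0r.
- by rewrite ppow0.
Qed.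

Lemma pideal_cap L (A B : pideal L) :
  exists C : pideal L, forall x, x \in C <-> x \in A /\ x \in B.
Proof.
apply: pideal_of_pred => [|a x y [xA xB] [yA yB]|x y [yA yB]|x [xA xB]].
- by rewrite !mem0v.
- by rewrite !memvD ?memvZ.
- by rewrite !pideal_lbr.
- by rewrite !pideal_ppow.
Qed.

Lemma in_centraliser_lbr L (S : {vspace L}) (x y : L) :
    (forall s, s \in S -> lbr x s \in S) ->
  in_centraliser S y -> in_centraliser S (lbr x y).
Proof.
move=> xS yS s sS; apply: lbr_eq0C.
rewrite lbr_leibniz (lbr_eq0C (yS s sS)) lbr0r addr0 lbrC yS ?oppr0 //.
by rewrite lbrC rpredN xS.
Qed.

Lemma centraliser_pideal L (S : {vspace L}) :
    (forall x y, y \in S -> lbr x y \in S) ->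
  exists C : pideal L, forall x, x \in C <-> in_centraliser S x.
Proof.
move=> Sl; apply: pideal_of_pred => [|a x y xS yS|x y yS|x xS].
- by move=> s _; rewrite lbr0l.
- by move=> s sS; rewrite lbrDl lbrZl xS ?yS // scaler0 addr0.
- by apply: in_centraliser_lbr => // s; apply: Sl.
- by move=> s sS; rewrite ppow_centralises ?xS.
Qed.

Lemma pideal_eq0 L (K : pideal L) :
  (K : {vspace L}) = 0%VS \/ exists2 x, x \in K & x != 0.
Proof.
have [->|K0] := eqVneq (K : {vspace L}) 0%VS; [by left | right].
by exists (vpick K); rewrite ?memv_pick ?vpick0.
Qed.

(** The form in which minimality is used: a [p]-ideal inside A is all of A as
    soon as it has one nonzero element. *)
Lemma min_pidealP L (A B : pideal L) x :
    min_pideal A -> (forall y, y \in B -> y \in A) -> x \in B -> x != 0 ->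
  forall y, y \in A -> y \in B.
Proof.
move=> [_ minA] /subvP sBA xB x0 y yA; rewrite (minA B) // => B0.
by move: xB x0; rewrite B0 memv0 => ->.
Qed.

(** * Morphisms *)

Section Morphisms.
Variables (L M : rlieType F p) (f : 'Hom(L, M)).
Hypothesis f_morph : rlie_morphism f.

Lemma morph_lbr x y : f (lbr x y) = lbr (f x) (f y).
Proof. exact: f_morph.1. Qed.
Lemma morph_ppow x : f (ppow x) = ppow (f x).
Proof. exact: f_morph.2. Qed.

Lemma ker_pideal : exists K : pideal L, forall x, x \in K <-> f x = 0.
Proof.
apply: pideal_of_pred => [|a x y fx fy|x y fy|x fx].
- exact: linear0.
- by rewrite linearP /= fx fy scaler0 addr0.
- by rewrite morph_lbr fy lbr0r.
- by rewrite morph_ppow fx ppow0.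
Qed.

Lemma psubalg_preim (W : psubalg M) :
  exists U : psubalg L, forall x, x \in U <-> f x \in W.
Proof.
apply: psubalg_of_pred => [|a x y fx fy|x y fx fy|x fx].
- by rewrite linear0 mem0v.
- by rewrite linearP memvD ?memvZ.
- by rewrite morph_lbr psubalg_lbr.
- by rewrite morph_ppow psubalg_ppow.
Qed.

Lemma psubalg_img (U : psubalg L) :
  exists W : psubalg M, forall y, y \in W <-> exists2 x, x \in U & f x = y.
Proof.
apply: psubalg_of_pred => [|a _ _ [x xU <-] [y yU <-]|_ _ [x xU <-] [y yU <-]|
  _ [x xU <-]].
- by exists 0; rewrite ?mem0v ?linear0.
- by exists (a *: x + y); rewrite ?linearP ?memvD ?memvZ.
- by exists (lbr x y); rewrite ?morph_lbr ?psubalg_lbr.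
- by exists (ppow x); rewrite ?morph_ppow ?psubalg_ppow.
Qed.

Lemma pideal_preim (J : pideal M) :
  exists K : pideal L, forall x, x \in K <-> f x \in J.
Proof.
apply: pideal_of_pred => [|a x y fx fy|x y fy|x fx].
- by rewrite linear0 mem0v.
- by rewrite linearP memvD ?memvZ.
- by rewrite morph_lbr pideal_lbr.
- by rewrite morph_ppow pideal_ppow.
Qed.

Lemma pideal_img (K : pideal L) : (forall y, exists x, f x = y) ->
  exists J : pideal M, forall y, y \in J <-> exists2 x, x \in K & f x = y.
Proof.
move=> f_surj; apply: pideal_of_pred => [|a _ _ [x xU <-] [y yU <-]|
  z _ [y yU <-]|_ [x xU <-]].
- by exists 0; rewrite ?mem0v ?linear0.
- by exists (a *: x + y); rewrite ?linearP ?memvD ?memvZ.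
- by have [x <-] := f_surj z; exists (lbr x y); rewrite ?morph_lbr ?pideal_lbr.
- by exists (ppow x); rewrite ?morph_ppow ?pideal_ppow.
Qed.

Lemma morph_corestrict (W : psubalg M) : (forall x, f x \in W) ->
  exists g : 'Hom(L, psub W), rlie_morphism g /\ forall x, psub_val (g x) = f x.
Proof.
move=> fW; pose g x : psub W := vsproj W (f x).
have gE x : psub_val (g x) = f x by rewrite /psub_val /g vsprojK ?fW.
have [a x y|g' g'E] := @hom_of_linear F L (psub W) g.
  apply: subvs_inj; rewrite [LHS]gE.
  transitivity (a *: psub_val (g x) + psub_val (g y)) => //.
  by rewrite !gE; apply: (linearP f).
exists g'; do 2?split; move=> x * /=; rewrite ?g'E ?gE //; apply: subvs_inj.
  by rewrite [LHS]gE [LHS]morph_lbr -!gE.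
by rewrite [LHS]gE [LHS]morph_ppow -gE.
Qed.

End Morphisms.

Lemma comp_morph L M N (g : 'Hom(M, N)) (f : 'Hom(L, M)) :
  rlie_morphism g -> rlie_morphism f -> rlie_morphism (g \o f)%VF.
Proof.
move=> g_morph f_morph; split=> [x y|x]; rewrite !comp_lfunE.
  by rewrite !morph_lbr.
by rewrite !morph_ppow.
Qed.

Lemma id_morph L : rlie_morphism (\1%VF : 'Hom(L, L)).
Proof. by split=> *; rewrite !id_lfunE. Qed.

Lemma id_surj L (x : L) : exists y, (\1%VF : 'Hom(L, L)) y = x.
Proof. by exists x; rewrite id_lfunE. Qed.

Lemma psub_inclE L (U : psubalg L) (x : psub U) : psub_incl U x = psub_val x.
Proof. by rewrite lfunE. Qed.

Lemma psub_incl_morph L (U : psubalg L) : rlie_morphism (psub_incl U).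
Proof. by split=> *; rewrite !psub_inclE. Qed.

Lemma psub_valP L (U : psubalg L) (x : psub U) : psub_val x \in U.
Proof. exact: subvsP. Qed.

Lemma psub_val_surj L (U : psubalg L) x : x \in U ->
  exists u : psub U, psub_val u = x.
Proof. by move=> xU; exists (Subvs xU). Qed.

Lemma morph_restrict L M (f : 'Hom(L, M)) (U : psubalg L) (W : psubalg M) :
    rlie_morphism f -> (forall x, x \in U -> f x \in W) ->
  exists g : 'Hom(psub U, psub W),
    rlie_morphism g /\ forall x, psub_val (g x) = f (psub_val x).
Proof.
move=> f_morph fUW.
have fi_morph := comp_morph f_morph (psub_incl_morph U).
have [|g [g_morph gE]] := morph_corestrict (W := W) fi_morph.
  by move=> x; rewrite comp_lfunE /= psub_inclE fUW ?psub_valP.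
by exists g; split=> // x; rewrite gE comp_lfunE /= psub_inclE.
Qed.

Lemma restrict_preim L M (q : 'Hom(L, M)) (U : psubalg L) (W : psubalg M) :
    rlie_morphism q -> (forall y, exists x, q x = y) ->
    (forall x, x \in U <-> q x \in W) ->
  exists g : 'Hom(psub U, psub W), [/\ rlie_morphism g,
    forall x, psub_val (g x) = q (psub_val x) & forall y, exists x, g x = y].
Proof.
move=> q_morph q_surj UP.
have [|g [g_morph gE]] := morph_restrict (U := U) (W := W) q_morph.
  by move=> x /UP.
exists g; split=> // y; have [x xE] := q_surj (psub_val y).
have xU : x \in U by apply/UP; rewrite xE psub_valP.
have [u uE] := psub_val_surj xU; exists u; apply: subvs_inj.
by rewrite [LHS]gE uE.
Qed.

Lemma dim_lt_surj L M (f : 'Hom(L, M)) x :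
  f x = 0 -> x != 0 -> (forall y, exists x, f x = y) ->
  (\dim {:M} < \dim {:L})%N.
Proof.
move=> fx0 x0 f_surj; rewrite -(limg_ker_dim f {:L}).
have <- : (f @: {:L} = {:M})%VS.
  apply/vspaceP => y; rewrite memvf; have [z <-] := f_surj y.
  by rewrite memv_img ?memvf.
rewrite -[X in (X < _)%N]add0n ltn_add2r lt0n dimv_eq0; apply/negP => /eqP ker0.
by move: x0; rewrite -memv0 -ker0 memv_cap memvf memv_ker fx0 eqxx.
Qed.

(** The homomorphism theorem; h composes f with a linear section of q. *)
Lemma morph_factor L M N (q : 'Hom(L, M)) (f : 'Hom(L, N)) :
    rlie_morphism q -> rlie_morphism f -> (forall y, exists x, q x = y) ->
    (forall x, q x = 0 -> f x = 0) ->
  exists h : 'Hom(M, N), rlie_morphism h /\ forall x, h (q x) = f x.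
Proof.
move=> q_morph f_morph q_surj qf; pose h := (f \o q^-1)%VF.
have hE x : h (q x) = f x.
  rewrite comp_lfunE /=; apply/eqP; rewrite -subr_eq0 -linearB; apply/eqP/qf.
  by rewrite linearB /= limg_lfunVK ?subrr ?memv_img ?memvf.
exists h; split=> //; split=> [y1 y2|y].
  have [[x1 <-] [x2 <-]] := (q_surj y1, q_surj y2).
  by rewrite -morph_lbr // !hE morph_lbr.
by have [x <-] := q_surj y; rewrite -morph_ppow // !hE morph_ppow.
Qed.

Lemma quo_iso L M (f : 'Hom(L, M)) (K : pideal L) :
    rlie_morphism f -> (forall y, exists x, f x = y) ->
    (forall x, x \in K <-> f x = 0) ->
  (exists h : 'Hom(pquo K, M), rlie_morphism h /\ bijective h) /\
  exists h : 'Hom(M, pquo K), rlie_morphism h /\ bijective h.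
Proof.
move=> f_morph f_surj kerf; have q_morph := quo_proj_morph K.
have [||h [h_morph hE]] := morph_factor q_morph f_morph.
- exact: quo_proj_surj.
- by move=> x /eqP; rewrite quo_proj_eq0 => /kerf.
have [||g [g_morph gE]] := morph_factor f_morph q_morph => //.
  by move=> x /kerf xK; apply/eqP; rewrite quo_proj_eq0.
have ghK : cancel h g.
  by move=> y; have [x <-] := quo_proj_surj y; rewrite hE gE.
have hgK : cancel g h by move=> y; have [x <-] := f_surj y; rewrite gE hE.
by split; [exists h | exists g]; split=> //; [exists g | exists h].
Qed.

(** * Solubility *)

Lemma sub_lbrv L (U V W : {vspace L}) :
  (forall u v, u \in U -> v \in V -> lbr u v \in W) -> (lbrv U V <= W)%VS.
Proof.
move=> UVW; apply/span_subvP => _ /allpairsP[[u v] /= [uU vV ->]].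
by apply: UVW; apply: vbasis_mem.
Qed.

Lemma derived_ideal L n (x y : L) :
  y \in derived_series L n -> lbr x y \in derived_series L n.
Proof.
elim: n x y => [|n IHn] x y; first by rewrite !memvf.
have [||W WP] :=
  @vspace_of_pred F L (fun y => lbr x y \in derived_series L n.+1).
- by rewrite lbr0r mem0v.
- by move=> a u v ux vx; rewrite lbrDr lbrZr memvD ?memvZ.
move=> yD; apply/WP; apply: subvP yD; apply: sub_lbrv => u v uD vD; apply/WP.
by rewrite /= lbr_leibniz memvD ?memv_lbrv ?IHn.
Qed.

Lemma soluble_surj L M (f : 'Hom(L, M)) :
  rlie_morphism f -> (forall y, exists x, f x = y) -> soluble L -> soluble M.
Proof.
move=> f_morph f_surj [n Dn0]; exists n.
suff: (derived_series M n <= f @: derived_series L n)%VS.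
  by rewrite Dn0 limg0 subv0 => /eqP.
elim: {Dn0}n => [|n IHn] /=.
  by apply/subvP => y _; have [x <-] := f_surj y; rewrite memv_img ?memvf.
apply: sub_lbrv => u v /(subvP IHn)/memv_imgP[x xD ->].
move=> /(subvP IHn)/memv_imgP[y yD ->].
by rewrite -morph_lbr // memv_img // memv_lbrv.
Qed.

Lemma soluble_psub L (U : psubalg L) : soluble L -> soluble (psub U).
Proof.
move=> [n Dn0]; exists n; apply/eqP; rewrite -subv0.
suff DU :
    (derived_series (psub U) n <= psub_incl U @^-1: derived_series L n)%VS.
  apply/subvP => x /(subvP DU); rewrite Dn0 -memv_preim psub_inclE !memv0.
  by move=> /eqP x0; apply/eqP/subvs_inj.
elim: {Dn0}n => [|n IHn] /=.
  by apply/subvP => x _; rewrite -memv_preim memvf.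
apply: sub_lbrv => x y /(subvP IHn) + /(subvP IHn).
rewrite -!memv_preim (morph_lbr (psub_incl_morph U)); exact: memv_lbrv.
Qed.

(** * Minimal ideals and primitive algebras *)

Lemma min_pideal_exists L (K : pideal L) : (K : {vspace L}) <> 0%VS ->
  exists2 A : pideal L, min_pideal A & (A <= K)%VS.
Proof.
have [n] := ubnP (\dim K); elim: n K => // n IHn K dimK K0.
have [minK|] := classic (min_pideal K); first by exists K.
move=> nminK; have [B [B0 sBK neqBK]] : exists B : pideal L,
    [/\ (B : {vspace L}) <> 0%VS, (B <= K)%VS & (B : {vspace L}) <> K].
  apply: NNPP => noB; apply: nminK; split=> // B B0 sBK.
  by apply: NNPP => neqBK; apply: noB; exists B.
have [|//|A minA sAB] := IHn B.
  rewrite ltnS in dimK; apply: leq_trans dimK.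
  rewrite ltnNge; apply/negP => dimKB; apply: neqBK.
  by apply/eqP; rewrite eqEdim sBK.
by exists A; last exact: subv_trans sBK.
Qed.

(** The last nonzero intersection B of A with the derived series is an abelian
    ideal, though perhaps not closed under the p-operation. Its centraliser
    is, so minimality, used twice, gives A <= C(B), and then A <= C(A). *)
Lemma min_pideal_abelian L (A : pideal L) : soluble L -> min_pideal A ->
  forall x y, x \in A -> y \in A -> lbr x y = 0.
Proof.
move=> [N DN0] minA.
have exD : exists n, (derived_series L n :&: A == 0)%VS.
  by exists N; rewrite DN0 cap0v.
have [[|n] Dn0 minn] := ex_minnP exD.
  by case: minA.1; apply/eqP; rewrite -[X in X == _]capfv.
pose B := (derived_series L n :&: A)%VS.
have Bn0 : B != 0%VS by apply/negP => /minn; rewrite ltnn.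
have Bl x y : y \in B -> lbr x y \in B.
  by rewrite !memv_cap => /andP[yD yA]; rewrite derived_ideal ?pideal_lbr.
have BB x y : x \in B -> y \in B -> lbr x y = 0.
  move=> xB yB; apply/eqP; rewrite -memv0 -(eqP Dn0) memv_cap.
  move: xB yB; rewrite !memv_cap => /andP[xD xA] /andP[yD yA].
  by rewrite pideal_lbr // andbT memv_lbrv.
have [b bB b0] : exists2 b, b \in B & b != 0.
  by exists (vpick B); rewrite ?memv_pick ?vpick0.
have sBA x : x \in B -> x \in A by rewrite memv_cap => /andP[].
have [CB CBP] := centraliser_pideal Bl; have [K KP] := pideal_cap A CB.
have AK x : x \in A -> in_centraliser B x.
  move=> xA; suff /KP[_ /CBP] : x \in K by [].
  apply: min_pidealP minA _ _ b0 x xA; first by move=> y /KP[].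
  by apply/KP; split; [exact: sBA | apply/CBP => s; exact: BB].
have [CA CAP] := centraliser_pideal (@pideal_lbr _ _ _ A).
have [K' K'P] := pideal_cap A CA.
move=> x y xA; suff /K'P[_ /CAP xC] : x \in K' by exact: xC.
apply: min_pidealP minA _ _ b0 x xA; first by move=> z /K'P[].
apply/K'P; split; [exact: sBA | apply/CAP => s sA].
by apply: lbr_eq0C; apply: AK.
Qed.

Lemma primitive_iso L M (h : 'Hom(L, M)) :
  rlie_morphism h -> bijective h -> primitive L -> primitive M.
Proof.
move=> h_morph [g ghK hgK] [solL [A [[A0 minA] CA]]].
have h_surj y : exists x, h x = y by exists (g y).
split; first exact: soluble_surj h_morph h_surj solL.
have [J JP] := pideal_img h_morph A h_surj.
have hA x : h x \in J <-> x \in A.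
  split=> [/JP[x' x'A /(can_inj ghK)<-] //|xA].
  by apply/JP; exists x.
have [//|[a aA a0]] := pideal_eq0 A.
exists J; split; first split.
- move=> J0; have: h a \in J by apply/hA.
  by rewrite J0 memv0 -(linear0 h) (inj_eq (can_inj ghK)) (negPf a0).
- move=> B B0 /subvP sBJ; have [K KP] := pideal_preim h_morph B.
  have KA : (K : {vspace L}) = A.
    apply: minA; last by apply/subvP => x /KP/sBJ/hA.
    have [//|[b bB b0] K0] := pideal_eq0 B.
    have /KP : h (g b) \in B by rewrite hgK.
    by rewrite K0 memv0 => /eqP gb0; rewrite -(hgK b) gb0 linear0 eqxx in b0.
  apply/vspaceP => y; apply/idP/idP => [/sBJ //|].
  by rewrite -(hgK y) => /hA; rewrite -KA => /KP.
- move=> y; rewrite -(hgK y); split.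
    move=> yC; apply/hA/CA => a' a'A.
    apply: (can_inj ghK); rewrite linear0 morph_lbr //; apply: yC; exact/hA.
  move=> /hA/CA yC z; rewrite -(hgK z) => /hA/yC.
  by rewrite -morph_lbr // => ->; rewrite linear0.
Qed.

(** Commuting nilpotent operators have a common kernel vector: given one for
    s, apply the next operator to it as often as the result stays nonzero. *)
Lemma common_kernel L (A : pideal L) (s : seq L) :
    (exists2 a, a \in A & a != 0) ->
    (forall b a, b \in s -> a \in A -> iter p (lbr b) a = 0) ->
    (forall b c a, b \in s -> c \in s -> a \in A ->
      lbr b (lbr c a) = lbr c (lbr b a)) ->
  exists2 a, a \in A & a != 0 /\ forall b, b \in s -> lbr b a = 0.
Proof.
move=> A0; elim: s => [|b s IHs] nilp comm; first by have [a] := A0; exists a.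
have sS c : c \in s -> c \in b :: s by rewrite inE => ->; rewrite orbT.
have [||a aA [a0 sa0]] := IHs.
- by move=> c x /sS; apply: nilp.
- by move=> c d x /sS cS /sS; apply: comm.
have iterA n : iter n (lbr b) a \in A.
  by elim: n => //= n IHn; rewrite pideal_lbr.
have exn : exists n, iter n (lbr b) a == 0.
  by exists p; rewrite nilp ?mem_head.
have [[|n] /= bn0 minn] := ex_minnP exn; first by rewrite bn0 in a0.
exists (iter n (lbr b) a) => //; split.
  by apply/negP => /minn; rewrite ltnn.
move=> c; rewrite inE => /predU1P[->|cs]; first exact/eqP.
have: lbr c a = 0 by apply: sa0.
elim: n {bn0 minn} => //= n IHn ca0.
by rewrite comm ?mem_head ?sS // IHn // lbr0r.
Qed.

(** The kernel of ad z on A is a [p]-ideal of L, because [z, L] <= A acts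
    trivially on A; it is proper as z is not in C_L(A) = A, so it is zero by
    minimality. Thus ad z maps A onto A, which already contains [z, L], and
    every x in L can be corrected by an element of A to centralise z. *)
Lemma complement_of_central_mod L (A : pideal L) z :
    min_pideal A -> (forall x, in_centraliser A x <-> x \in A) ->
    (forall x, lbr z x \in A) -> z \notin A ->
  exists U : psubalg L, (forall x, exists2 u, u \in U & x - u \in A) /\
    forall x, x \in U -> x \in A -> x = 0.
Proof.
move=> minA CA zLA zA.
have abA x y : x \in A -> y \in A -> lbr x y = 0 by move=> /CA xC /xC.
have [|ad adE] := @hom_of_linear F L L (lbr z); first exact: lbr_linearr.
have [||||C CP] := @psubalg_of_pred L (fun x => lbr x z = 0).
- by rewrite lbr0l.
- by move=> a x y xz yz; rewrite lbrDl lbrZl xz yz scaler0 addr0.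
- by move=> x y xz yz; apply: lbr_eq0C; rewrite lbr_leibniz (lbr_eq0C xz)
    (lbr_eq0C yz) lbr0l lbr0r addr0.
- by move=> x xz; rewrite ppow_centralises.
have [||||K KP] := @pideal_of_pred L (fun x => x \in A /\ lbr x z = 0).
- by rewrite mem0v lbr0l.
- move=> a x y [xA xz] [yA yz].
  by rewrite memvD ?memvZ // lbrDl lbrZl xz yz scaler0 addr0.
- move=> x y [yA yz]; split; first exact: pideal_lbr.
  by apply: lbr_eq0C; rewrite lbr_leibniz (lbr_eq0C yz) lbr0r addr0 abA.
- by move=> x [xA xz]; rewrite pideal_ppow ?ppow_centralises.
have AC x : x \in A -> lbr x z = 0 -> x = 0.
  move=> xA xz; apply/eqP/negPn/negP => x0; case/negP: zA; apply/CA.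
  move=> a aA; apply: lbr_eq0C.
  have xK : x \in K by apply/KP.
  have KA y : y \in K -> y \in A by case/KP.
  by have /KP[] := min_pidealP minA KA xK x0 aA.
exists C; split=> x; last by move=> /CP xz xA; apply: AC.
have adA : (ad @: A = A)%VS.
  apply/eqP; rewrite eqEdim; apply/andP; split.
    by apply/subvP => _ /memv_imgP[y yA ->]; rewrite adE pideal_lbr.
  rewrite limg_dim_eq //; apply/eqP; rewrite -subv0; apply/subvP => y.
  rewrite memv_cap memv_ker adE memv0 => /andP[yA /eqP zy].
  by apply/eqP/AC => //; apply: lbr_eq0C.
have: ad x \in A by rewrite adE.
rewrite -{1}adA => /memv_imgP[a aA]; rewrite !adE => zx.
exists (x - a); last by rewrite opprB addrC subrK.
by apply/CP/lbr_eq0C; rewrite lbrBr zx subrr.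
Qed.

(** The witness is z = b^[p], for b in the last term B of the derived series
    not contained in A: since p > 1 and ad(b)^2 L <= [B, B] <= A, the map
    ad(b^[p]) = ad(b)^p sends L into A. *)
Lemma central_mod_self_centralising L (A : pideal L) :
    soluble L -> min_pideal A -> (forall x, in_centraliser A x <-> x \in A) ->
    ~ (forall x, x \in A) ->
  exists2 z, z \notin A & forall x, lbr z x \in A.
Proof.
move=> [N DN0] minA CA nAL.
have abA x y : x \in A -> y \in A -> lbr x y = 0 by move=> /CA xC /xC.
have exD : exists n, (derived_series L n <= A)%VS.
  by exists N; rewrite DN0 sub0v.
have [[|n] Dn1A minn] := ex_minnP exD.
  by case: nAL => x; apply: (subvP Dn1A); apply: memvf.
pose B := derived_series L n.
have BA : ~ (B <= A)%VS by move=> /minn; rewrite ltnn.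
have BB x y : x \in B -> y \in B -> lbr x y \in A.
  by move=> xB yB; apply: (subvP Dn1A); rewrite /= memv_lbrv.
have LB x y : y \in B -> lbr x y \in B by apply: derived_ideal.
have ppowBA b x : b \in B -> lbr (ppow b) x \in A.
  move=> bB; rewrite ppow_ad.
  suff iterA m : (1 < m)%N -> iter m (lbr b) x \in A by apply: iterA.
  case: m => [|[|m]] // _; elim: m => [|m IHm] /=; last by rewrite pideal_lbr.
  by rewrite BB // lbrC rpredN LB.
have [[b [bB zA]]|pBA] := classic (exists b, b \in B /\ ppow b \notin A).
  by exists (ppow b) => // x; apply: ppowBA.
(* Now B acts on A by commuting nilpotent operators, so it kills some a <> 0. *)
have ppowB b : b \in B -> ppow b \in A.
  by move=> bB; apply/negPn/negP => zA; apply: pBA; exists b.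
have [/minA.1 //|A0] := pideal_eq0 A.
have [||a aA [a0 Ba0]] := @common_kernel L A (vbasis B) A0.
- by move=> b a /vbasis_mem/ppowB bA aA; rewrite -ppow_ad abA.
- move=> b c a /vbasis_mem bB /vbasis_mem cB aA.
  by rewrite lbr_leibniz [lbr (lbr _ _) _]abA ?BB ?add0r.
(* By minimality B centralises A, hence is contained in A. *)
have [CB CBP] := centraliser_pideal LB; have [K KP] := pideal_cap A CB.
case: BA; apply/subvP => b bB; apply/CA => x xA.
suff /KP[_ /CBP xB] : x \in K by apply/lbr_eq0C/xB.
apply: min_pidealP minA _ _ a0 x xA; first by move=> y /KP[].
apply/KP; split=> //; apply/CBP => c cB; apply: lbr_eq0C.
have [||W WP] := @vspace_of_pred F L (fun c => lbr c a = 0).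
- by rewrite lbr0l.
- by move=> k x y xa ya; rewrite lbrDl lbrZl xa ya scaler0 addr0.
apply/WP; move: cB; rewrite -{1}(span_basis (vbasisP B)).
by apply/subvP/span_subvP => d dB; apply/WP/Ba0.
Qed.

Lemma primitive_complement L (A : pideal L) :
    soluble L -> min_pideal A -> (forall x, in_centraliser A x <-> x \in A) ->
  exists U : psubalg L, (forall x, exists2 u, u \in U & x - u \in A) /\
    forall x, x \in U -> x \in A -> x = 0.
Proof.
move=> solL minA CA.
have [AL|nAL] := classic (forall x, x \in A); last first.
  have [z zA zLA] := central_mod_self_centralising solL minA CA nAL.
  exact: complement_of_central_mod zLA zA.
have [||||U UP] := @psubalg_of_pred L (fun x => x = 0) => //.
- by move=> a x y -> ->; rewrite scaler0 addr0.
- by move=> x y -> _; rewrite lbr0l.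
- by move=> x ->; rewrite ppow0.
exists U; split=> x; last by move=> /UP.
by exists 0; rewrite ?mem0v.
Qed.

(** * Homomorphs and covering subalgebras *)

Section Classes.
Variable X : rlieType F p -> Prop.
Hypothesis homX : p_homomorph X.

Lemma class_surj L M (f : 'Hom(L, M)) :
  rlie_morphism f -> (forall y, exists x, f x = y) -> X L -> X M.
Proof.
move=> f_morph f_surj XL; have [[_ isoX] _ quoX] := homX.
have [K KP] := ker_pideal f_morph.
have [[h [h_morph h_bij]] _] := quo_iso f_morph f_surj KP.
by apply: (isoX (pquo K)); [exists h | exact: quoX].
Qed.

Lemma class_quo L M (f : 'Hom(L, M)) (K : pideal L) :
    rlie_morphism f -> (forall y, exists x, f x = y) ->
    (forall x, x \in K <-> f x = 0) ->
  (X (pquo K) <-> X M) /\ (primitive M -> primitive (pquo K)).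
Proof.
move=> f_morph f_surj KP.
have [[h [h_morph [h' hh' h'h]]] [g [g_morph g_bij]]] :=
  quo_iso f_morph f_surj KP.
split; last exact: primitive_iso g_morph g_bij.
have [g' gg' g'g] := g_bij.
split; first by apply: (class_surj h_morph) => y; exists (h' y).
by apply: (class_surj g_morph) => y; exists (g' y).
Qed.

Lemma class_full L (U : psubalg L) :
  (forall x, x \in U) -> (X (psub U) <-> X L).
Proof.
move=> UL; split.
  apply: (class_surj (psub_incl_morph U)) => x.
  by have [u <-] := psub_val_surj (UL x); exists u; rewrite psub_inclE.
have [|g [g_morph gE]] := morph_corestrict (W := U) (id_morph L).
  by move=> x; apply: UL.
apply: (class_surj g_morph) => u; exists (psub_val u); apply: subvs_inj.
by rewrite [LHS]gE id_lfunE.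
Qed.

Lemma class_img L M (f : 'Hom(L, M)) (U : psubalg L) (W : psubalg M) :
    rlie_morphism f -> (forall y, y \in W <-> exists2 x, x \in U & f x = y) ->
  X (psub U) -> X (psub W).
Proof.
move=> f_morph WP.
have [|g [g_morph gE]] := morph_restrict (U := U) (W := W) f_morph.
  by move=> x xU; apply/WP; exists x.
apply: (class_surj g_morph) => y; have [x xU fx] := (WP _).1 (psub_valP y).
have [u uE] := psub_val_surj xU; exists u; apply: subvs_inj.
by rewrite [LHS]gE uE.
Qed.

(** For injective i this is the defining property of covering subalgebras with
    V the image of i and K the kernel of f. Non-injective i are allowed so that
    the property of a subalgebra of L/K applies directly to N -> L -> L/K. *)
Definition covers L (U : psubalg L) : Prop :=
  X (psub U) /\
  forall N M (i : 'Hom(N, L)) (f : 'Hom(N, M)),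
    rlie_morphism i -> rlie_morphism f -> (forall m, exists n, f n = m) ->
    X M -> (forall u, u \in U -> exists n, i n = u) ->
  forall m, exists2 n, i n \in U & f n = m.

Lemma coversP L (U : psubalg L) : covering_subalg X U <-> covers U.
Proof.
split=> [[XU covU]|[XU covU]]; split=> //.
  move=> N M i f i_morph f_morph f_surj XM iU m.
  have [T TP] := psubalg_full N.
  have [V VP] := psubalg_img i_morph T.
  have iV n : i n \in V by apply/VP; exists n.
  have [q [q_morph qE]] := morph_corestrict (W := V) i_morph iV.
  have q_surj v : exists n, q n = v.
    have /VP[n _ nE] := psub_valP v; exists n; apply: subvs_inj.
    by rewrite [LHS]qE.
  have [Ki KiP] := ker_pideal i_morph.
  have [J JP] := pideal_img f_morph Ki f_surj.
  have qf_morph := comp_morph (quo_proj_morph J) f_morph.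
  have [|f' [f'_morph f'E]] := morph_factor q_morph qf_morph q_surj.
    move=> n qn0; rewrite comp_lfunE /=; apply/eqP; rewrite quo_proj_eq0.
    by apply/JP; exists n => //; apply/KiP; rewrite -qE qn0.
  have f'_surj y : exists v, f' v = y.
    have [m' <-] := quo_proj_surj y; have [n <-] := f_surj m'.
    by exists (q n); rewrite f'E comp_lfunE.
  have [K KP] := ker_pideal f'_morph.
  (* V/K is isomorphic to M/J, where J = f (ker i) measures the failure of f to
     factor through i; elements of J come from ker i, which i maps into U. *)
  have XJ : X (pquo J).
    by apply: (class_surj (quo_proj_morph J)) XM; apply: quo_proj_surj.
  have XK : X (pquo K) by apply/(class_quo f'_morph f'_surj KP).1.
  have sUV : (U <= V)%VS by apply/subvP => u /iU[n <-].
  have [n0 n0E] := f_surj m.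
  have : i n0 \in (U + psub_incl V @: K)%VS by rewrite covU.
  move=> /memv_addP[u uU [_ /memv_imgP[k kK ->]]]; rewrite psub_inclE => inE.
  have [n1 n1E] := iU u uU.
  have qn0 : q n0 = q n1 + k.
    by apply: subvs_inj; rewrite [LHS]qE inE -n1E -qE.
  have : f' (q n0) = f' (q n1).
    by rewrite qn0 linearD /= [f' k](KP k).1 ?addr0.
  rewrite !f'E !comp_lfunE /= => /eqP; rewrite -subr_eq0 -linearB quo_proj_eq0.
  move=> /JP[n2 /KiP in2 n2E]; exists (n1 + n2).
    by rewrite linearD /= in2 addr0 n1E.
  by rewrite linearD /= n2E addrC subrK.
move=> V sUV K XK.
have iE := @psub_inclE L V.
apply/eqP; rewrite eqEsubv; apply/andP; split.
  rewrite subv_add sUV; apply/subvP => _ /memv_imgP[k _ ->].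
  by rewrite iE psub_valP.
apply/subvP => v vV; have [w wE] := psub_val_surj vV.
have [|n nU nE] := covU _ _ (psub_incl V) (quo_proj K) (psub_incl_morph V)
  (quo_proj_morph K) (@quo_proj_surj _ _ _ K) XK _ (quo_proj K w).
  move=> u /(subvP sUV) uV; have [x <-] := psub_val_surj uV.
  by exists x; rewrite iE.
rewrite -wE -iE -[w](subrK n) addrC linearD /= memv_add // memv_img //.
by rewrite -quo_proj_eq0 linearB /= nE subrr.
Qed.

Lemma quo_imgP L (K : pideal L) (U : psubalg L) y :
  y \in quo_img K U <-> exists2 u, u \in U & quo_proj K u = y.
Proof.
rewrite /= quo_img_eq; split=> [/memv_imgP[u uU ->]|[u uU <-]].
  by exists u.
exact: memv_img.
Qed.

Lemma covers_projector L (U : psubalg L) : covers U -> projector X U.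
Proof.
move=> [XU covU] K; split.
  exact: class_img (quo_proj_morph K) (@quo_imgP _ K U) XU.
move=> V XV /subvP sUV; apply/vspaceP => y; apply/idP/idP => [yV|/sUV //].
have q_morph := quo_proj_morph K.
have [W WP] := psubalg_preim q_morph V.
have [g [g_morph gE g_surj]] :=
  restrict_preim q_morph (@quo_proj_surj _ _ _ K) WP.
have [v vE] := psub_val_surj yV.
have [u uU|n nU nE] :=
  covU _ _ _ _ (psub_incl_morph W) g_morph g_surj XV _ v.
  have uW : u \in W by apply/WP/sUV/quo_imgP; exists u.
  by have [w wE] := psub_val_surj uW; exists w; rewrite psub_inclE.
by apply/quo_imgP; exists (psub_val n); rewrite -?gE ?nE // -psub_inclE.
Qed.

(** Let f : N -> M be as in [covers]. As E' covers, already the part D of N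
    over E maps onto M; as U' covers, so does the part of D over U'. The image
    of N in L/K contains E' because U' maps onto E', which is in X. *)
Lemma covers_lift L (K : pideal L) (E' : psubalg (pquo K)) (E : psubalg L)
    (U' : psubalg (psub E)) :
    (forall x, x \in E <-> quo_proj K x \in E') -> covers E' -> covers U' ->
  exists U : psubalg L, covers U.
Proof.
move=> EP [XE' covE'] [XU' covU'].
have e_morph := psub_incl_morph E.
have q_morph := quo_proj_morph K.
have [U UP] := psubalg_img e_morph U'.
exists U; split; first exact: class_img e_morph UP XU'.
move=> N M i f i_morph f_morph f_surj XM iU m.
have E'U y : y \in E' -> exists2 u, u \in U & quo_proj K u = y.
  move=> yE'.
  have [g [g_morph gE g_surj]] :=
    restrict_preim q_morph (@quo_proj_surj _ _ _ K) EP.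
  have [v vE] := psub_val_surj yE'.
  have [u _|n + nE] := covU' _ _ _ _ (id_morph _) g_morph g_surj XE' _ v.
    by exists u; rewrite id_lfunE.
  rewrite id_lfunE => nU'; exists (psub_val n).
    by apply/UP; exists n; rewrite // psub_inclE.
  by rewrite -gE nE.
have qi_morph := comp_morph q_morph i_morph.
have [D DP] := psubalg_preim qi_morph E'.
have iD n : n \in D <-> i n \in E.
  by split=> [/DP|/EP niE]; [|apply/DP]; rewrite comp_lfunE //= => /EP.
have f_surjD m' : exists2 n, n \in D & f n = m'.
  have [y /E'U[u /iU[n <-] <-]|n nD nE] :=
    covE' _ _ _ _ qi_morph f_morph f_surj XM _ m'.
    by exists n; rewrite comp_lfunE.
  by exists n => //; apply/DP.
have [|j [j_morph jE]] := morph_restrict (U := D) (W := E) i_morph.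
  by move=> n /iD.
have fD_morph := comp_morph f_morph (psub_incl_morph D).
have [m'|u uU'|n nU' nE] := covU' _ _ _ _ j_morph fD_morph _ XM _ m.
- have [n nD <-] := f_surjD m'; have [d <-] := psub_val_surj nD.
  by exists d; rewrite comp_lfunE /= psub_inclE.
- have uU : psub_val u \in U by apply/UP; exists u; rewrite // psub_inclE.
  have [n nE] := iU _ uU.
  have nD : n \in D by apply/iD; rewrite nE psub_valP.
  have [d dE] := psub_val_surj nD.
  by exists d; apply: subvs_inj; rewrite [LHS]jE dE.
exists (psub_val n); last by rewrite -nE comp_lfunE /= psub_inclE.
by apply/UP; exists (j n); rewrite // psub_inclE jE.
Qed.

Lemma covers_full L : X L -> exists U : psubalg L, covers U.
Proof.
move=> XL; have [U UL] := psubalg_full L.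
exists U; split; first exact/class_full.
move=> N M i f _ _ f_surj _ _ m; have [n <-] := f_surj m.
by exists n.
Qed.

(** A subalgebra V containing U is U or L, as A :&: V is an ideal of
    L = U + A. A quotient of L in X has a nonzero kernel since L is not in X,
    and this kernel contains A: otherwise it would meet A trivially, hence
    centralise A, hence be contained in A. *)
Lemma covers_complement L (A : pideal L) (U : psubalg L) :
    ~ X L -> X (pquo A) -> min_pideal A ->
    (forall x, in_centraliser A x <-> x \in A) ->
    (forall x, exists2 u, u \in U & x - u \in A) ->
    (forall x, x \in U -> x \in A -> x = 0) ->
  covers U.
Proof.
move=> nXL XLA minA CA UA UA0; apply/coversP.
have q_morph := quo_proj_morph A.
have abA x y : x \in A -> y \in A -> lbr x y = 0 by move=> /CA xC /xC.
have XU : X (psub U).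
  have e_morph := comp_morph q_morph (psub_incl_morph U).
  have eE u : (quo_proj A \o psub_incl U)%VF u = quo_proj A (psub_val u).
    by rewrite comp_lfunE /= psub_inclE.
  have [|u|h [h_morph hE]] := morph_factor e_morph (id_morph (psub U)).
  - move=> y; have [x <-] := quo_proj_surj y; have [u uU xuA] := UA x.
    have [w wE] := psub_val_surj uU; exists w; apply/eqP.
    by rewrite eq_sym -subr_eq0 eE wE -linearB quo_proj_eq0.
  - rewrite eE => /eqP; rewrite quo_proj_eq0 id_lfunE => uA.
    by apply: subvs_inj; apply: UA0; rewrite ?psub_valP.
  apply: (class_surj h_morph) XLA => u; exists (quo_proj A (psub_val u)).
  by rewrite -eE hE id_lfunE.
split=> // V sUV K XK; apply/eqP; rewrite eqEsubv; apply/andP; split.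
  rewrite subv_add sUV; apply/subvP => _ /memv_imgP[k _ ->].
  by rewrite psub_inclE psub_valP.
(* If A and V meet trivially, V = U by the modular law. *)
have [[a [aA aV a0]]|VA0] := classic (exists a, [/\ a \in A, a \in V & a != 0]);
    last first.
  apply: subv_trans (addvSl _ _); apply/subvP => v vV.
  have [u uU vuA] := UA v; suff /eqP : v - u = 0 by rewrite subr_eq0 => /eqP->.
  apply/eqP/negPn/negP => vu0; apply: VA0; exists (v - u); split=> //.
  by rewrite memvB // (subvP sUV).
(* Otherwise their intersection is a nonzero ideal, so A <= V and V = L. *)
have [||||I IP] := @pideal_of_pred L (fun x => x \in A /\ x \in V).
- by rewrite !mem0v.
- by move=> c x y [xA xV] [yA yV]; rewrite !memvD ?memvZ.
- move=> x y [yA yV]; rewrite pideal_lbr //; split=> //.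
  have [u uU xuA] := UA x; rewrite -[x](subrK u) lbrDl abA // add0r.
  by rewrite psubalg_lbr // (subvP sUV).
- by move=> x [xA xV]; rewrite pideal_ppow ?psubalg_ppow.
have VL x : x \in V.
  have [u uU xuA] := UA x; rewrite -[x](subrK u).
  apply: memvD; last exact: (subvP sUV).
  suff /IP[] : x - u \in I by [].
  apply: min_pidealP minA _ _ a0 _ xuA; last exact/IP.
  by move=> y /IP[].
have i_morph := psub_incl_morph V.
have i_surj x : exists v, psub_incl V v = x.
  by have [v vE] := psub_val_surj (VL x); exists v; rewrite psub_inclE.
have [K' K'P] := pideal_img i_morph K i_surj.
have [K0|[k kK k0]] := pideal_eq0 K.
  case: nXL; apply/(class_full VL).
  apply/(class_quo (K := K) (id_morph _) _ _).1 => //.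
  - exact: id_surj.
  - by move=> x; rewrite K0 id_lfunE memv0; split=> /eqP.
have kK' : psub_val k \in K' by apply/K'P; exists k; rewrite // psub_inclE.
have [J JP] := pideal_cap A K'.
have [c [cA cK' c0]] : exists c, [/\ c \in A, c \in K' & c != 0].
  have [kA|] := boolP (psub_val k \in A).
    by exists (psub_val k).
  move=> nkA; apply: NNPP => noc; case/negP: nkA; apply/CA => b bA.
  apply/eqP/negPn/negP => kb0; apply: noc; exists (lbr (psub_val k) b).
  by rewrite pideal_lbr // pideal_lbrl.
apply/subvP => v _; have [u uU vuA] := UA v.
rewrite -[v](subrK u) addrC memv_add //.
suff /JP[_ /K'P[x xK <-]] : v - u \in J by rewrite memv_img.
apply: min_pidealP minA _ _ c0 _ vuA; last exact/JP.
by move=> y /JP[].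
Qed.

Lemma primitive_image_mem L M (f : 'Hom(L, M)) :
    (forall K : pideal L, primitive (pquo K) -> X (pquo K)) ->
    rlie_morphism f -> (forall y, exists x, f x = y) -> primitive M -> X M.
Proof.
move=> primX f_morph f_surj primM; have [K KP] := ker_pideal f_morph.
have [XKM primK] := class_quo f_morph f_surj KP.
by apply/XKM/primX/primK.
Qed.

Lemma Schunck_covers : p_Schunck_class X ->
  forall L, soluble L -> exists U : psubalg L, covers U.
Proof.
move=> [_ _ schX] L; have [n] := ubnP (\dim {:L}).
elim: n L => // n IHn L; rewrite ltnS => dimL solL.
have [/covers_full //|nXL] := classic (X L).
have lift (K : pideal L) : (K : {vspace L}) <> 0%VS ->
    X (pquo K) \/ exists U : psubalg L, covers U.
  have [//|[k kK k0] _] := pideal_eq0 K.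
  have q_morph := quo_proj_morph K.
  have q_surj := @quo_proj_surj _ _ _ K.
  have qk0 : quo_proj K k = 0 by apply/eqP; rewrite quo_proj_eq0.
  have [||E' covE'] := IHn (pquo K).
  - exact: leq_trans (dim_lt_surj qk0 k0 q_surj) dimL.
  - exact: soluble_surj q_morph q_surj solL.
  have [E EP] := psubalg_preim q_morph E'.
  have [EL|nEL] := classic (forall x, x \in E).
    left; apply/(class_full (U := E')); last exact: covE'.1.
    by move=> y; have [x <-] := q_surj y; apply/EP.
  right; have [||U' covU'] := IHn (psub E).
  - apply: leq_trans dimL; rewrite dimvf /= ltnNge; apply/negP => dimLE.
    apply: nEL => x.
    suff <- : {:L}%VS = E :> {vspace L} by rewrite memvf.
    by apply/esym/eqP; rewrite eqEdim subvf.
  - exact: soluble_psub.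
  exact: covers_lift EP covE' covU'.
(* For K <> 0, [lift] applies since L/K is not in X; so let K = 0. *)
have [K primK nXK] : exists2 K : pideal L, primitive (pquo K) & ~ X (pquo K).
  apply: NNPP => noK; apply: nXL; apply/schX; split=> // K primK.
  by apply: NNPP => nXK; apply: noK; exists K.
have [K0|/lift[] //] := classic ((K : {vspace L}) = 0%VS).
have K0P x : x \in K <-> (\1%VF : 'Hom(L, L)) x = 0.
  by rewrite K0 memv0 id_lfunE; split=> /eqP.
have [[h [h_morph h_bij]] _] := quo_iso (id_morph L) (@id_surj L) K0P.
have [_ [A [minA CA]]] := primitive_iso h_morph h_bij primK.
have [XA|//] := lift A minA.1.
have [U [UA UA0]] := primitive_complement solL minA CA.
by exists U; apply: covers_complement CA UA UA0.
Qed.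

Lemma projective_Schunck : projective X -> p_Schunck_class X.
Proof.
have [solX exX quoX] := homX.
move=> projX; split=> // L; split=> [XL|].
  by split=> [|K _]; [exact: solX.1 | exact: quoX].
have [n] := ubnP (\dim {:L}); elim: n L => // n IHn L.
rewrite ltnS => dimL [solL primX].
have [U projU] := projX L solL.
have XU : X (psub U).
  have [O OP] := pideal_zero L.
  have [x|h [h_morph hE]] :=
    morph_factor (quo_proj_morph O) (id_morph L) (@quo_proj_surj _ _ _ O).
    by move=> /eqP; rewrite quo_proj_eq0 id_lfunE => /OP.
  apply: (class_img h_morph) (projU O).1 => y; split=> [yU|].
    exists (quo_proj O y); last by rewrite hE id_lfunE.
    by apply/quo_imgP; exists y.
  by move=> [_ /quo_imgP[u uU <-] <-]; rewrite hE id_lfunE.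
have [UL|nUL] := classic (forall x, x \in U); first exact/(class_full UL).
(* Proper quotients of L are in X by induction, so U covers them. *)
have UK (K : pideal L) k : k \in K -> k != 0 ->
    forall x, exists2 u, u \in U & x - u \in K.
  move=> kK k0 x; have q_morph := quo_proj_morph K.
  have q_surj := @quo_proj_surj _ _ _ K.
  have qk0 : quo_proj K k = 0 by apply/eqP; rewrite quo_proj_eq0.
  have XK : X (pquo K).
    apply: IHn; first exact: leq_trans (dim_lt_surj qk0 k0 q_surj) dimL.
    split=> [|J]; first exact: soluble_surj q_morph q_surj solL.
    have r_morph := comp_morph (quo_proj_morph J) q_morph.
    apply: (primitive_image_mem primX r_morph) => y.
    have [z <-] := quo_proj_surj y; have [w <-] := q_surj z.
    by exists w; rewrite comp_lfunE.
  have [T TP] := psubalg_full (pquo K).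
  have [_ maxU] := projU K.
  have : quo_proj K x \in quo_img K U.
    rewrite -(maxU T) ?TP //; first exact/class_full.
    by apply/subvP => y _; apply: TP.
  move=> /quo_imgP[u uU ux]; exists u => //.
  by rewrite -quo_proj_eq0 linearB /= ux subrr.
have [T TP] := pideal_full L.
have T0 : (T : {vspace L}) <> 0%VS.
  move=> T0; apply: nUL => x; suff /eqP-> : x == 0 by rewrite mem0v.
  by rewrite -memv0 -T0 TP.
have [A minA _] := min_pideal_exists T0.
have abA := min_pideal_abelian solL minA.
have [/minA.1 //|[a aA a0]] := pideal_eq0 A.
have UA := UK A a aA a0.
have primL : primitive L.
  split=> //; exists A; split=> // x; split; last by move=> xA y; apply: abA.
  have [u uU xuA] := UA x; move=> xC.
  suff u0 : u = 0 by rewrite u0 subr0 in xuA.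
  apply/eqP/negPn/negP => u0.
  have uC : in_centraliser A u.
    by move=> y yA; rewrite -[u](subKr x) lbrBl xC // abA // subr0.
  (* C_U(A) is normalised by U and centralised by A, hence an ideal of L. *)
  have [||||I IP] := @pideal_of_pred L (fun x => x \in U /\ in_centraliser A x).
  - by split=> [|y _]; rewrite ?mem0v ?lbr0l.
  - move=> c y z [yU yC] [zU zC].
    split=> [|w wA]; first by rewrite memvD ?memvZ.
    by rewrite lbrDl lbrZl yC ?zC // scaler0 addr0.
  - move=> y z [zU zC]; split.
      have [v vU yvA] := UA y; rewrite -[y](subrK v) lbrDl.
      by rewrite (lbr_eq0C (zC _ yvA)) add0r psubalg_lbr.
    by apply: in_centraliser_lbr => // s; apply: pideal_lbr.
  - move=> y [yU yC]; split=> [|w wA]; first exact: psubalg_ppow.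
    by rewrite ppow_centralises ?yC.
  apply: nUL => y; have uI : u \in I by apply/IP.
  have [v vU /IP[yvU _]] := UK I u uI u0 y.
  by rewrite -[y](subrK v) memvD.
exact: primitive_image_mem primX (id_morph L) (@id_surj L) primL.
Qed.

End Classes.

End RestrictedLie.

Theorem theorem4p14 (F : fieldType) (p : nat) (charFp : p \in [pchar F])
    (X : rlieType F p -> Prop) (homX : p_homomorph X) :
  (Gaschutz X <-> projective X) /\ (projective X <-> p_Schunck_class X).
Proof.
have GP : Gaschutz X -> projective X.
  move=> G L /G[U covU]; exists U.
  by apply: (covers_projector charFp homX); apply/(coversP charFp homX).
have PS : projective X -> p_Schunck_class X by apply: projective_Schunck homX.
have SG : p_Schunck_class X -> Gaschutz X.
  move=> S L solL; have [U covU] := Schunck_covers charFp homX S solL.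
  by exists U; apply/(coversP charFp homX).
by split; split=> [|H] //; [apply: SG; apply: PS | apply: GP; apply: SG].
Qed.
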